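(* The following assertions are equivalent: (1) Semifilter trichotomy. (2) For each unbounded $S\subseteq[\mathbb{N}]^{\aleph_0}$, there is an increasing $h\in\mathbb{N}^{\mathbb{N}}$ such that $S/h$ is a base for either an ultrafilter, or for $[\mathbb{N}]^{\aleph_0}$. (3) For each unbounded $S\subseteq[\mathbb{N}]^{\aleph_0}$, there is an increasing $h\in\mathbb{N}^{\mathbb{N}}$ such that $S/h$ is reaping.
   Context: $[\mathbb{N}]^{\aleph_0}$ is the set of infinite subsets of $\mathbb{N}=\{0,1,2,\dots\}$. For $a,b\in[\mathbb{N}]^{\aleph_0}$, $a\subseteq^* b$ means $a\setminus b$ is finite. A semifilter is a nonempty $F\subseteq[\mathbb{N}]^{\aleph_0}$ such that $a\in F$, $b\in[\mathbb{N}]^{\aleph_0}$ and $a\subseteq^* b$ imply $b\in F$. A filter is a semifilter closed under finite intersections (ultrafilters here are accordingly nonprincipal). The Fréchet filter is the set of all cofinite subsets of $\mathbb{N}$. For a nonempty $S\subseteq[\mathbb{N}]^{\aleph_0}$, $\langle S\rangle=\{b\in[\mathbb{N}]^{\aleph_0} : (\exists a\in S)\ a\subseteq^* b\}$; $S$ is a base for a semifilter $F$ if $F=\langle S\rangle$. For $a\in[\mathbb{N}]^{\aleph_0}$ and a (strictly) increasing $h\in\mathbb{N}^{\mathbb{N}}$, $a/h=\{n : a\cap[h(n),h(n+1))\neq\emptyset\}$, and $S/h=\{a/h : a\in S\}$ for $S\subseteq[\mathbb{N}]^{\aleph_0}$. Semifilter trichotomy is the statement: for each semifilter $S$ there is an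 increasing $h\in\mathbb{N}^{\mathbb{N}}$ such that $S/h$ is either the Fréchet filter, or an ultrafilter, or $[\mathbb{N}]^{\aleph_0}$. Each $a\in[\mathbb{N}]^{\aleph_0}$ is identified with its increasing enumeration in $\mathbb{N}^{\mathbb{N}}$; $S\subseteq[\mathbb{N}]^{\aleph_0}$ is unbounded if, viewed as a subset of $\mathbb{N}^{\mathbb{N}}$, it is unbounded with respect to $\le^*$ (where $f\le^* g$ means $f(n)\le g(n)$ for all but finitely many $n$), i.e. there is no $g\in\mathbb{N}^{\mathbb{N}}$ with $f\le^* g$ for all $f\in S$. A family $R\subseteq[\mathbb{N}]^{\aleph_0}$ is reaping if there is no $a\subseteq\mathbb{N}$ such that for all $r\in R$ both $r\cap a$ and $r\setminus a$ are infinite. *)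

(* Defs.v *)
From mathcomp Require Import all_boot.
From mathcomp Require Import boolp classical_sets cardinality filter.

Set Implicit Arguments.
Unset Strict Implicit.
Unset Printing Implicit Defensive.

Local Open Scope classical_set_scope.

(* [N]^aleph_0; the families S of infinite subsets of N are the
   S : set (set nat) such that S `<=` infsets. *)
Definition infsets : set (set nat) := [set a | infinite_set a].

Definition almost_sub (a b : set nat) : Prop := finite_set (a `\` b).

Definition semifilter (F : set (set nat)) : Prop :=
  [/\ F !=set0,
      F `<=` infsets
    & forall a b, F a -> infsets b -> almost_sub a b -> F b].

(* Unlike the library's Filter, members are infinite and closure is under
   almost-supersets, so every filter or ultrafilter in this sense contains the
   Frechet filter (hence is nonprincipal). *)
Definition filter_on_nat (F : set (set nat)) : Prop :=
  semifilter F /\ setI_closed F.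

Definition ultrafilter_on_nat (U : set (set nat)) : Prop :=
  filter_on_nat U /\ forall G, filter_on_nat G -> U `<=` G -> G = U.

Definition upclosure (S : set (set nat)) : set (set nat) :=
  [set b | infsets b /\ exists2 a, S a & almost_sub a b].

Definition base_for (S F : set (set nat)) : Prop :=
  [/\ S !=set0, S `<=` infsets, semifilter F & F = upclosure S].

Definition increasing (h : nat -> nat) : Prop :=
  {homo h : m n / (m < n)%N}.

Definition quot (h : nat -> nat) (a : set nat) : set nat :=
  [set n | a `&` [set k | (h n <= k < h n.+1)%N] !=set0].

Definition quot_family (h : nat -> nat) (S : set (set nat)) : set (set nat) :=
  [set quot h a | a in S].

Definition semifilter_trichotomy : Prop :=
  forall S, semifilter S -> exists2 h, increasing h &
    [\/ quot_family h S = @frechet_filter nat,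
        ultrafilter_on_nat (quot_family h S)
      | quot_family h S = infsets].

Definition le_star (f g : nat -> nat) : Prop :=
  cofinite_set [set n | (f n <= g n)%N].

(* S viewed as a subset of N^N: an increasing function is identified with its
   range, and every infinite set is the range of exactly one increasing
   function (infsets_enum below). *)
Definition enumerations (S : set (set nat)) : set (nat -> nat) :=
  [set f | increasing f /\ S (range f)].

Definition unbounded (S : set (set nat)) : Prop :=
  ~ exists g : nat -> nat, forall f, enumerations S f -> le_star f g.

Definition reaping (R : set (set nat)) : Prop :=
  R `<=` infsets /\
  ~ exists a : set nat, forall r, R r ->
      infinite_set (r `&` a) /\ infinite_set (r `\` a).

Lemma increasing_ge (f : nat -> nat) : increasing f -> forall n, (n <= f n)%N.
Proof. by move=> fi; elim=> // n /leq_ltn_trans; apply; apply: fi. Qed.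

Lemma infsets_enum (a : set nat) :
  infsets a -> exists! f, increasing f /\ range f = a.
Proof.
move=> ia.
have ex n : exists m, `[< a m /\ (n <= m)%N >].
  apply: contrapT => H; apply: ia.
  apply: (sub_finite_set _ (finite_II n)) => k ak /=.
  by rewrite ltnNge; apply/negP => nk; apply: H; exists k; apply/asboolP.
pose next n := ex_minn (ex n).
have nextP n : a (next n) /\ (n <= next n)%N.
  by rewrite /next; case: ex_minnP => m /asboolP.
have next_min n k : a k -> (n <= k)%N -> (next n <= k)%N.
  rewrite /next; case: ex_minnP => m _ + ak nk; apply.
  exact/asboolP.
pose fix e n := if n is n'.+1 then next (e n').+1 else next 0.
have ei : increasing e.
  apply: homo_ltn => [|n]; first exact: ltn_trans.
  by have [] := nextP (e n).+1.
have ae n : a (e n) by case: n => [|n]; [case: (nextP 0)|case: (nextP (e n).+1)].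
have eE : range e = a.
  apply/seteqP; split=> [_ [n _ <-]//|k ak].
  have exk : exists n, (k <= e n)%N by exists k; exact: increasing_ge.
  exists (ex_minn exk) => //; case: ex_minnP => -[|n] kn minn; apply/eqP;
    rewrite eqn_leq kn andbT; first exact: next_min.
  apply: next_min => //; rewrite ltnNge; apply/negP => /minn.
  by rewrite ltnn.
exists e; split=> // f [fi fE].
have fa n : a (f n) by rewrite -fE; exists n.
have fiW : {homo f : m n / (m <= n)%N} by apply: ltnW_homo.
have fsurj k : a k -> exists n, f n = k by rewrite -fE => -[n _ <-]; exists n.
have flt m n : (f m < f n)%N -> (m < n)%N.
  by apply: contraTT; rewrite -!leqNgt => /fiW.
apply/funext; elim=> [|n IH] /=; apply/eqP; rewrite eqn_leq; apply/andP; split.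
- exact: next_min.
- by have [a0 _] := nextP 0%N; have [m <-] := fsurj _ a0; apply: fiW.
- by apply: next_min => //; rewrite IH; apply: fi.
- have [an ln] := nextP (e n).+1; have [m mE] := fsurj _ an.
  by rewrite -mE; apply/fiW/flt; rewrite mE -IH.
Qed.

(* Main.v *)
Require Import Defs.
From mathcomp Require Import all_boot.
From mathcomp Require Import boolp classical_sets cardinality filter.

(** The proof runs through the dual of a semifilter F, the family of sets whose
    complement is not in F; equivalently, the sets that meet every member of F
    in an infinite set.  Duality is an order-reversing involution, exchanges the
    Frechet filter with the family of all infinite sets, and commutes with the
    quotients by h: such a quotient is the image of F under the
    finite-to-one map sending k to the index of the interval of h
    containing k (quot_semifilterE, quot_dual).  A semifilter is reaping exactly
    when it contains its dual (reaping_dualP), and an ultrafilter is a filter that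
    contains its dual (ultrafilter_dualP).

    Boundedness has a combinatorial meaning: a semifilter is bounded exactly when
    some quotient of it is the Frechet filter (bounded_quot_frechet,
    quot_cofinite_bounded).  With this, trichotomy gives the second assertion:
    the semifilter generated by an unbounded S is unbounded, so the Frechet
    alternative is excluded, and S / h generates the quotient of that semifilter.
    The second assertion gives the third because an ultrafilter and the family
    of all infinite sets both contain their duals.

    Deriving trichotomy from the third assertion is the substantial part.  The
    third assertion provides, for every unbounded semifilter F, an h such that
    (dual F) / h is included in F / h.  Given a semifilter S, a bounded S has a
    Frechet quotient, so let S be unbounded and let R be a quotient of S
    containing its dual.
    - If dual R is bounded, it has a Frechet quotient, and dually R has a
      quotient consisting of all infinite sets.
    - If dual R is unbounded, a quotient of dual R contains the corresponding
      quotient T of R = dual (dual R); since dual R is included in R, this makes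
      T self-dual.  Let U be any ultrafilter.  The semifilter of common members
      of T and U is unbounded (self_dual_meets_ultrafilter): otherwise its dual,
      the union of T and U, would have a quotient consisting of all infinite
      sets.  But the quotients of T and U are included in their duals, so
      neither has two disjoint members, and among three pairwise disjoint
      infinite sets one belongs to neither.  Applying the third assertion to the
      intersection of T and U, whose dual is their union, gives an h for which
      (union) / h is included in (intersection) / h.  Hence T / h = U / h, an
      ultrafilter. *)

Set Implicit Arguments.
Unset Strict Implicit.
Unset Printing Implicit Defensive.

Local Open Scope classical_set_scope.

(** * Interval partitions and quotients *)

Lemma increasing_leE h : increasing h -> {mono h : m n / (m <= n)%N}.
Proof. exact: leq_mono. Qed.

Lemma increasing_ltE h : increasing h -> {mono h : m n / (m < n)%N}.
Proof. by move=> hi; apply/leqW_mono/increasing_leE. Qed.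

Lemma increasing_comp h k : increasing h -> increasing k -> increasing (h \o k).
Proof. by move=> hi ki m n mn; apply/hi/ki. Qed.

(** The index of the interval of h containing k.  The points below h 0 lie in no
    interval; sending them to 0 makes block h a total map, so that preimages
    under it commute exactly with complements and intersections. *)
Definition block (h : nat -> nat) (k : nat) : nat :=
  xget 0 [set n | (h n <= k < h n.+1)%N].

Lemma block_bounds h k : increasing h -> (h 0 <= k)%N ->
  (h (block h k) <= k < h (block h k).+1)%N.
Proof.
move=> hi h0k; apply: (@xgetPex _ 0 [set n | (h n <= k < h n.+1)%N]).
have ex : exists n, (k < h n.+1)%N by exists k; apply: increasing_ge.
exists (ex_minn ex) => /=; case: ex_minnP => -[|n] -> minn; rewrite andbT //.
by rewrite leqNgt; apply/negP => /minn; rewrite ltnn.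
Qed.

Lemma block_lt h k : increasing h -> (k < h (block h k).+1)%N.
Proof.
move=> hi; have [h0k|kh0] := leqP (h 0) k.
  by have /andP[] := block_bounds hi h0k.
by apply: ltn_trans kh0 _; apply: hi.
Qed.

Lemma block_eq h n k : increasing h -> (h n <= k < h n.+1)%N -> block h k = n.
Proof.
move=> hi /andP[hnk khn].
have h0k : (h 0 <= k)%N by apply: leq_trans hnk; rewrite increasing_leE.
have /andP[hbk khb] := block_bounds hi h0k.
apply/eqP; rewrite eqn_leq -ltnS -[X in _ && X]ltnS.
rewrite -(increasing_ltE hi) (leq_ltn_trans hbk khn).
by rewrite -(increasing_ltE hi) (leq_ltn_trans hnk khb).
Qed.

Lemma block_h h n : increasing h -> block h (h n) = n.
Proof. by move=> hi; apply: block_eq; rewrite ?leqnn ?hi. Qed.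

(** Finiteness is reflected in both directions: the fibre of block h over n is
    contained in [0, h (n + 1)), and block h is onto. *)
Lemma block_finite_to_one h d : increasing h ->
  finite_set (block h @^-1` d) <-> finite_set d.
Proof.
move=> hi; split=> fd.
  apply: (sub_finite_set _ (finite_image (block h) fd)) => n dn.
  by exists (h n); rewrite /= block_h.
apply: (@sub_finite_set _ _ (\bigcup_(n in d) `I_(h n.+1))) => [k dk|].
  by exists (block h k) => //=; apply: block_lt.
by apply: bigcup_finite => // n _; apply: finite_II.
Qed.

Lemma quot_block h c : increasing h -> quot h (block h @^-1` c) = c.
Proof.
move=> hi; apply/seteqP; split=> [n [k [/= ck /(block_eq hi) <-]]//|n cn].
by exists (h n); split; rewrite /= ?block_h // leqnn hi.
Qed.

Lemma quot_comp h k a : increasing h -> increasing k ->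
  quot k (quot h a) = quot (h \o k) a.
Proof.
move=> hi ki; apply/seteqP; split=> n /=.
  move=> [m [[i [ai /= /andP[hmi ihm]]] /= /andP[knm mkn]]].
  exists i; split=> //=; apply/andP; split.
    by apply: leq_trans hmi; rewrite increasing_leE.
  by apply: leq_trans ihm _; rewrite increasing_leE.
move=> [i [ai /= /andP[hki ihk]]].
have h0i : (h 0 <= i)%N by apply: leq_trans hki; rewrite increasing_leE.
have /andP[hbi ihb] := block_bounds hi h0i.
exists (block h i); split=> /=; first by exists i; split=> //=; apply/andP.
rewrite -ltnS -(increasing_ltE hi) (leq_ltn_trans hki ihb).
by rewrite -(increasing_ltE hi) (leq_ltn_trans hbi ihk).
Qed.

Lemma quot_family_comp h k S : increasing h -> increasing k ->
  quot_family k (quot_family h S) = quot_family (h \o k) S.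
Proof.
move=> hi ki; rewrite /quot_family image_comp; apply: eq_imagel => a _ /=.
exact: quot_comp.
Qed.

(** * Almost inclusion and semifilters *)

Lemma almost_sub_refl a : almost_sub a a.
Proof. by rewrite /almost_sub setDv. Qed.

Lemma almost_sub_trans a b c :
  almost_sub a b -> almost_sub b c -> almost_sub a c.
Proof.
move=> ab bc; apply: (@sub_finite_set _ _ ((a `\` b) `|` (b `\` c))).
  by move=> k [ak ck]; have [bk|bk] := pselect (b k); [right|left].
by rewrite finite_setU.
Qed.

Lemma almost_sub_infsets a b : infsets a -> almost_sub a b -> infsets b.
Proof.
move=> ia ab fb; apply: ia.
apply: (@sub_finite_set _ _ ((a `\` b) `|` b)); last by rewrite finite_setU.
by move=> k ak; have [bk|bk] := pselect (b k); [right|left].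
Qed.

(** The quotient and the preimage under block h are adjoint modulo finite sets;
    the finite error comes from the points below h 0. *)
Lemma almost_sub_quot h a c : increasing h ->
  almost_sub (quot h a) c <-> almost_sub a (block h @^-1` c).
Proof.
move=> hi; split=> ac; last first.
  apply: (sub_finite_set _ (finite_image (block h) ac)).
  move=> n [[k [ak /(block_eq hi) kn]] cn].
  by exists k => //; split=> //=; rewrite kn.
have {}ac := (block_finite_to_one _ hi).2 ac.
apply: (@sub_finite_set _ _ (`I_(h 0) `|` block h @^-1` (quot h a `\` c))).
  move=> k [ak /= ck]; have [h0k|kh0] := leqP (h 0) k; [right|by left].
  by split=> //; exists k; split=> //=; apply: block_bounds.
by rewrite finite_setU; split=> //; apply: finite_II.
Qed.

Lemma quot_infsets h a : increasing h -> infsets a -> infsets (quot h a).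
Proof.
move=> hi ia fq; have /(almost_sub_quot _ _ hi) := almost_sub_refl (quot h a).
by move=> /(almost_sub_infsets ia); apply; apply/block_finite_to_one.
Qed.

Lemma quot_family_infsets h S : increasing h -> S `<=` infsets ->
  quot_family h S `<=` infsets.
Proof. by move=> hi Si _ [a Sa <-]; apply: quot_infsets => //; apply: Si. Qed.

Lemma semifilter_up F a b : semifilter F -> F a -> almost_sub a b -> F b.
Proof.
move=> [_ Fi Fup] Fa ab.
exact: Fup Fa (almost_sub_infsets (Fi _ Fa) ab) ab.
Qed.

Lemma sub_upclosure S : S `<=` infsets -> S `<=` upclosure S.
Proof.
by move=> Si a Sa; split; [exact: Si|exists a => //; apply: almost_sub_refl].
Qed.

Lemma semifilter_upclosure S : S !=set0 -> S `<=` infsets ->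
  semifilter (upclosure S).
Proof.
move=> [a Sa] Si; split=> [|b []//|b c [_ [d Sd db]] ic bc].
  by exists a; apply: sub_upclosure.
by split=> //; exists d => //; apply: almost_sub_trans db bc.
Qed.

Lemma upclosure_id F : semifilter F -> upclosure F = F.
Proof.
move=> sF; apply/seteqP; split=> [b [_ [a]]|]; first exact: semifilter_up.
by apply: sub_upclosure; case: sF.
Qed.

Lemma quot_family_upclosure h S : increasing h ->
  quot_family h (upclosure S) = upclosure (quot_family h S).
Proof.
move=> hi; apply/seteqP; split=> [_ [b [ib [a Sa ab]] <-]|c [ic [_ [a Sa <-]]]].
  split; first exact: quot_infsets.
  exists (quot h a); first by exists a.
  apply/(almost_sub_quot _ _ hi); apply: almost_sub_trans ab _.
  by apply/(almost_sub_quot _ _ hi); apply: almost_sub_refl.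
move=> /(almost_sub_quot _ _ hi) ac; exists (block h @^-1` c).
  split; last by exists a.
  by apply: contra_not ic => /(block_finite_to_one _ hi).
exact: quot_block.
Qed.

(** On semifilters the quotient is the pushforward along block h, which makes
    its compatibility with Boolean operations immediate. *)
Lemma quot_semifilterE h F : increasing h -> semifilter F ->
  quot_family h F = [set c | F (block h @^-1` c)].
Proof.
move=> hi sF; apply/seteqP; split=> [_ [a Fa <-] /=|c Fc]; last first.
  by exists (block h @^-1` c) => //; apply: quot_block.
apply: semifilter_up sF Fa _.
by apply/(almost_sub_quot _ _ hi); apply: almost_sub_refl.
Qed.

Lemma quot_semifilter h F : increasing h -> semifilter F ->
  semifilter (quot_family h F).
Proof.
move=> hi sF; have [[a Fa] Fi _] := sF.
rewrite -(upclosure_id sF) quot_family_upclosure //.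
apply: semifilter_upclosure; first by exists (quot h a); exists a.
exact: quot_family_infsets.
Qed.

Lemma semifilter_cofinite F a : semifilter F -> cofinite_set a -> F a.
Proof.
move=> sF fa; have [[b Fb] _ _] := sF; apply: semifilter_up sF Fb _.
by apply: sub_finite_set fa => k [].
Qed.

(** * Duality *)

(** For a semifilter F these are the sets whose intersection with every member of
    F is infinite.  The definition by complements makes duality an involution for
    every family F. *)
Definition dual (F : set (set nat)) : set (set nat) := [set a | ~ F (~` a)].

Lemma dualK F : dual (dual F) = F.
Proof.
apply/seteqP; split=> a; rewrite /dual /= setCK; first exact: contrapT.
by move=> Fa; apply.
Qed.

Lemma dualI F G : dual (F `&` G) = dual F `|` dual G.
Proof.
by apply/seteqP; split=> a; rewrite /dual /= not_andP.
Qed.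

Lemma quot_dual h F : increasing h -> semifilter F -> semifilter (dual F) ->
  quot_family h (dual F) = dual (quot_family h F).
Proof. by move=> hi sF sD; rewrite !quot_semifilterE. Qed.

Lemma semifilter_dual F : semifilter F -> semifilter (dual F).
Proof.
move=> sF; have [_ Fi _] := sF; split.
- by exists setT; rewrite /dual /= setCT => /Fi; apply.
- by move=> a nFa fa; apply: nFa; apply: semifilter_cofinite; rewrite ?setCK.
- move=> a b nFa _ ab Fb; apply: nFa; apply: semifilter_up sF Fb _.
  by apply: sub_finite_set ab => k [/= nb /contrapT].
Qed.

Lemma dual_frechet : dual (@frechet_filter nat) = infsets.
Proof. by apply/seteqP; split=> a; rewrite /dual /frechet_filter /= setCK. Qed.

Lemma semifilterI F G : semifilter F -> semifilter G -> semifilter (F `&` G).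
Proof.
move=> sF sG; have [_ Fi _] := sF.
split=> [|a [/Fi]//|a b [Fa Ga] _ ab].
  by exists setT; split; apply: semifilter_cofinite; rewrite ?setCT.
by split; [apply: semifilter_up sF Fa ab|apply: semifilter_up sG Ga ab].
Qed.

(** If the complement of a is not in the ultrafilter U, then a has an infinite
    intersection with every member of U, so the traces of U on a generate a filter
    extending U; by maximality that filter is U itself, and it contains a. *)
Lemma ultrafilter_dualP U :
  ultrafilter_on_nat U <-> filter_on_nat U /\ dual U `<=` U.
Proof.
split=> [[[sU UI] Umax]|[[sU UI] dU]]; last first.
  split=> // G [[_ Gi _] GI] UG; apply/seteqP; split=> // a Ga.
  apply: dU => /UG Gna; have := GI _ _ Ga Gna.
  by rewrite setICr => /Gi; apply.
have [_ Ui _] := sU; split=> // a nUa.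
have meets b : U b -> infsets (b `&` a).
  move=> Ub fba; apply: nUa; apply: semifilter_up sU Ub _.
  by rewrite /almost_sub setDE setCK.
pose B := [set b `&` a | b in U].
have UT : U setT by apply: semifilter_cofinite; rewrite ?setCT.
have sB : semifilter (upclosure B).
  apply: semifilter_upclosure; first by exists (setT `&` a); exists setT.
  by move=> _ [b Ub <-]; apply: meets.
rewrite -(Umax (upclosure B)); first 1 last.
- split=> // c d [ic [_ [b Ub <-] bc]] [id [_ [b' Ub' <-] bd]].
  have bcd : almost_sub ((b `&` b') `&` a) (c `&` d).
    apply: (@sub_finite_set _ _
      (((b `&` a) `\` c) `|` ((b' `&` a) `\` d))); last by rewrite finite_setU.
    move=> k [[[bk b'k] ak] /not_andP[nc|nd]]; first by left.
    by right.
  have iba := meets _ (UI _ _ Ub Ub').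
  split; first exact: almost_sub_infsets bcd.
  by exists ((b `&` b') `&` a) => //; exists (b `&` b') => //; apply: UI.
- move=> b Ub; split; first exact: Ui.
  exists (b `&` a); first by exists b.
  by rewrite /almost_sub setDE setIAC setICr set0I.
- split; first by rewrite -(setTI a); apply: meets.
  by exists (setT `&` a); [exists setT|rewrite setTI; apply: almost_sub_refl].
Qed.

Lemma filter_sub_dual F : filter_on_nat F -> F `<=` dual F.
Proof.
move=> [[_ Fi _] FI] a Fa Fna; have := FI _ _ Fa Fna.
by rewrite setICr => /Fi; apply.
Qed.

(** Maximality is hard to transport through a quotient, but inclusion of the dual
    passes to quotients at once. *)
Lemma quot_ultrafilter h U : increasing h -> ultrafilter_on_nat U ->
  ultrafilter_on_nat (quot_family h U).
Proof.
move=> hi /ultrafilter_dualP[[sU UI] dU]; apply/ultrafilter_dualP.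
split; first split; first exact: quot_semifilter.
  by rewrite quot_semifilterE // => a b /= Ua Ub; apply: UI.
by rewrite -quot_dual //; [apply: image_subset|apply: semifilter_dual].
Qed.

Lemma ultrafilter_exists : exists U, ultrafilter_on_nat U.
Proof.
have [U [UU fU]] := ultraFilterLemma frechet_properfilter_nat.
have UF : ProperFilter U := ultra_proper.
exists U; apply/ultrafilter_dualP; split; last first.
  by move=> a nUa; have [//|/nUa] := in_ultra_setVsetC a UU.
split; last by move=> a b; apply: filterI.
split; first by exists setT; apply: filterT.
  move=> a Ua fa; have Una : U (~` a).
    by apply: fU; rewrite /frechet_filter /= setCK.
  by apply: (@filter_not_empty _ U); rewrite -(setICr a); apply: filterI.
move=> a b Ua _ ab; have Uab : U (~` (a `\` b)).
  by apply: fU; rewrite /frechet_filter /= setCK.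
apply: filterS (filterI Ua Uab) => k [ak nabk].
by apply: contrapT => nbk; apply: nabk.
Qed.

(** * Bounded families and the Frechet filter *)

(** If g eventually bounds the enumeration f of a, then
    h n <= f (h n) <= g (h n) for almost all n.  So a has a point in almost every
    interval of h as soon as h (n + 1) exceeds g (h n). *)
Lemma bounded_quot_frechet F : semifilter F -> ~ unbounded F ->
  exists2 h, increasing h & quot_family h F = @frechet_filter nat.
Proof.
move=> sF /contrapT[g gF]; have [_ Fi _] := sF.
pose h := fix h n := if n is m.+1 then (maxn (h m) (g (h m))).+1 else 0%N.
have hS n : (h n < h n.+1)%N by rewrite /= ltnS leq_maxl.
have hi : increasing h by apply: homo_ltn => //; apply: ltn_trans.
have sq := quot_semifilter hi sF.
exists h => //; apply/seteqP; split; last first.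
  by move=> c; apply: semifilter_cofinite.
move=> _ [a Fa <-]; rewrite /frechet_filter /=.
have [f [[fi fa] _]] := infsets_enum (Fi _ Fa).
have fg : le_star f g by apply: gF; split=> //; rewrite fa.
apply: sub_finite_set (finite_image (block h) fg) => n nq.
exists (h n); last exact: block_h.
move=> /= fgn; apply: nq; exists (f (h n)); split.
  by rewrite -fa; exists (h n).
by rewrite /= increasing_ge //= ltnS (leq_trans fgn) // leq_maxr.
Qed.

Lemma finite_set_nat_lt (d : set nat) :
  finite_set d -> exists N, forall n, d n -> (n < N)%N.
Proof.
move=> /finite_seqP[s ->]; exists (\max_(i <- s) i).+1 => n /= sn.
by rewrite ltnS; apply: leq_bigmax_seq.
Qed.

(** If a meets the N-th interval of h and all later ones, then its n-th element
    lies below h (N + n + 1), hence below h (2 n) for n > N; the bound h (2 n)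
    depends neither on a nor on N. *)
Lemma quot_cofinite_bounded h S : increasing h ->
  quot_family h S `<=` @frechet_filter nat -> ~ unbounded S.
Proof.
move=> hi hS; apply; exists (fun n => h n.*2) => f [fi Sf].
have /finite_set_nat_lt[N ltN] : cofinite_set (quot h (range f)).
  by apply: hS; exists (range f).
have hits m : (N <= m)%N -> exists k, (h m <= f k < h m.+1)%N.
  move=> Nm; have [_ [[k _ <-]]] : quot h (range f) m.
    by apply: contrapT => /ltN; rewrite ltnNge Nm.
  by exists k.
have flt n : (f n < h (N + n).+1)%N.
  elim: n => [|n IH].
    have [k /andP[_ fk]] := hits N (leqnn N).
    by rewrite addn0; apply: leq_ltn_trans fk; rewrite increasing_leE.
  have [|k /andP[hk fk]] := hits (N + n).+1; first by rewrite leqW ?leq_addr.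
  rewrite addnS; apply: leq_ltn_trans fk; rewrite increasing_leE //.
  by rewrite -(increasing_ltE fi) (leq_trans IH hk).
apply: sub_finite_set (finite_II N.+1) => n /= /negP; rewrite -ltnNge => hn.
rewrite ltnNge; apply/negP => Nn; have := ltn_trans hn (flt n).
by rewrite increasing_ltE // ltnS -addnn leqNgt ltn_add2r Nn.
Qed.

(** * Reaping families *)

(** By closure under almost-supersets, a set a leaves some member of F unsplit
    exactly when a or its complement belongs to F. *)
Lemma reaping_dualP F : semifilter F -> reaping F <-> dual F `<=` F.
Proof.
move=> sF; have [_ Fi _] := sF; split=> [[_ nsplit] a nFa|dF].
  apply: contrapT => nFa'; apply: nsplit; exists a => r Fr; split=> fr.
    apply: nFa; apply: semifilter_up sF Fr _.
    by rewrite /almost_sub setDE setCK.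
  by apply: nFa'; apply: semifilter_up sF Fr fr.
split=> // -[a split_a]; have [Fa|nFa] := pselect (F a).
  by have [_] := split_a _ Fa; rewrite setDv; apply.
have /dF/split_a[] : dual F (~` a) by rewrite /dual /= setCK.
by rewrite setICl => /(_ (finite_set0 _)).
Qed.

Lemma reaping_upclosure S : S `<=` infsets ->
  reaping (upclosure S) -> reaping S.
Proof.
move=> Si [_ nsplit]; split=> // -[a split_a]; apply: nsplit; exists a.
move=> b [_ [r Sr rb]]; have [ira irda] := split_a r Sr.
split; [apply: almost_sub_infsets ira _|apply: almost_sub_infsets irda _];
  by apply: sub_finite_set rb => k [[rk ak] nk]; split=> // bk; apply: nk.
Qed.

(** * The three assertions *)

Lemma unbounded_upclosure S : S `<=` infsets -> unbounded S ->
  unbounded (upclosure S).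
Proof.
move=> Si unS [g gS]; apply: unS; exists g => f [fi Sf].
by apply: gS; split=> //; apply: sub_upclosure.
Qed.

Lemma unbounded_nonempty S : unbounded S -> S !=set0.
Proof.
move=> unS; apply/set0P/eqP => S0; apply: unS; exists id => f [_].
by rewrite S0.
Qed.

Lemma base_upclosure_quot h S : increasing h -> S !=set0 -> S `<=` infsets ->
  base_for (quot_family h S) (quot_family h (upclosure S)).
Proof.
move=> hi [a Sa] Si; split.
- by exists (quot h a); exists a.
- exact: quot_family_infsets.
- by apply/quot_semifilter => //; apply: semifilter_upclosure => //; exists a.
- exact: quot_family_upclosure.
Qed.

Lemma trichotomy_base : semifilter_trichotomy ->
  forall S : set (set nat), S `<=` infsets -> unbounded S ->
    exists2 h : nat -> nat, increasing h &
      (exists2 U, ultrafilter_on_nat U & base_for (quot_family h S) U)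
      \/ base_for (quot_family h S) infsets.
Proof.
move=> tri S Si unS; have S0 := unbounded_nonempty unS.
have [h hi Sh] := tri _ (semifilter_upclosure S0 Si).
exists h => //; have base := base_upclosure_quot hi S0 Si.
case: Sh => [Sh|Sh|<-]; [|by left; exists (quot_family h (upclosure S))|by right].
have /(quot_cofinite_bounded hi)[] :
    quot_family h (upclosure S) `<=` @frechet_filter nat by rewrite Sh.
exact: unbounded_upclosure.
Qed.

Lemma base_reaping S :
  (exists2 U, ultrafilter_on_nat U & base_for S U) \/ base_for S infsets ->
  reaping S.
Proof.
case=> [[U /ultrafilter_dualP[[sU _] dU] [_ Si _ US]]|[_ Si sI IS]];
  apply: reaping_upclosure Si _.
  by rewrite -US; apply/reaping_dualP.
by rewrite -IS; apply/reaping_dualP => //; case: (semifilter_dual sI).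
Qed.

Lemma sub_dual_meet F a b : semifilter F -> F `<=` dual F -> F a -> F b ->
  a `&` b !=set0.
Proof.
move=> sF FdF Fa Fb; apply/set0P/eqP => ab0; apply: (FdF a) => //.
by apply: semifilter_up sF Fb _; rewrite /almost_sub setDE setCK setIC ab0.
Qed.

(** A semifilter included in its dual has no two disjoint members, so each of F
    and G contains at most one of the three residue classes modulo 3. *)
Lemma infsets_not_cover F G : semifilter F -> semifilter G ->
  F `<=` dual F -> G `<=` dual G -> ~ infsets `<=` F `|` G.
Proof.
move=> sF sG FdF GdG cov; pose P i := [set n | n %% 3 = i].
have disj i j : i != j -> ~ (P i `&` P j !=set0).
  by move=> /eqP ij [n [/= ni nj]]; apply: ij; rewrite -ni.
have covP i : (i < 3)%N -> F (P i) \/ G (P i).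
  move=> i3; apply: cov => /finite_set_nat_lt[N PN].
  have /PN : P i (N * 3 + i) by rewrite /P /= modnMDl modn_small.
  by rewrite ltnNge (leq_trans (leq_pmulr N _) (leq_addr _ _)).
have FP i j : i != j -> F (P i) -> F (P j) -> False.
  by move=> /disj ij Fi Fj; apply: ij; apply: sub_dual_meet Fi Fj.
have GP i j : i != j -> G (P i) -> G (P j) -> False.
  by move=> /disj ij Gi Gj; apply: ij; apply: sub_dual_meet Gi Gj.
have [P0|P0] := covP 0 isT; have [P1|P1] := covP 1 isT;
  have [P2|P2] := covP 2 isT; by [apply: FP P0 P1|apply: FP P0 P2|
  apply: FP P1 P2|apply: GP P0 P1|apply: GP P0 P2|apply: GP P1 P2].
Qed.

(** If the intersection of T and U were bounded, some quotient of it would be the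
    Frechet filter; dually, the quotients of T and U, both included in their
    duals, would together contain every infinite set. *)
Lemma self_dual_meets_ultrafilter T U : semifilter T -> dual T = T ->
  ultrafilter_on_nat U -> unbounded (T `&` U).
Proof.
move=> sT dT ultraU; apply: contrapT => bTU.
have [fU dU] := (ultrafilter_dualP U).1 ultraU; have [sU _] := fU.
have sTU := semifilterI sT sU.
have [h hi hTU] := bounded_quot_frechet sTU bTU.
apply: (@infsets_not_cover (quot_family h T) (quot_family h U)).
- exact: quot_semifilter.
- exact: quot_semifilter.
- by rewrite -quot_dual ?dT.
- rewrite -quot_dual //; last exact: semifilter_dual.
  by apply: image_subset; apply: filter_sub_dual.
- rewrite -dual_frechet -hTU -quot_dual //; last exact: semifilter_dual.
  rewrite dualI dT -image_setU; apply: image_subset; exact: setUS.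
Qed.

(** The third assertion is used three times: to get a quotient R of S containing
    its dual, to get a self-dual quotient T of R, and to identify a quotient of T
    with a quotient of an ultrafilter.  Each further quotient keeps what was
    gained, since quotients preserve inclusions and commute with duality. *)
Lemma reaping_trichotomy :
  (forall S : set (set nat), S `<=` infsets -> unbounded S ->
     exists2 h : nat -> nat, increasing h & reaping (quot_family h S)) ->
  semifilter_trichotomy.
Proof.
move=> reap.
have dual_sub F : semifilter F -> unbounded F ->
    exists2 h, increasing h & quot_family h (dual F) `<=` quot_family h F.
  move=> sF unF; have [_ Fi _] := sF; have [h hi reapF] := reap _ Fi unF.
  exists h => //; rewrite quot_dual //; last exact: semifilter_dual.
  by apply/reaping_dualP => //; apply: quot_semifilter.
move=> S sS; have [unS|bS] := pselect (unbounded S); last first.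
  by have [h hi Sh] := bounded_quot_frechet sS bS; exists h => //; apply: Or31.
have [h1 h1i dS1] := dual_sub S sS unS; pose R := quot_family h1 S.
have sR : semifilter R by apply: quot_semifilter.
have sdR := semifilter_dual sR.
have dRR : dual R `<=` R by rewrite -quot_dual //; apply: semifilter_dual.
have [undR|bdR] := pselect (unbounded (dual R)); last first.
  have [h2 h2i dR2] := bounded_quot_frechet sdR bdR.
  exists (h1 \o h2); first exact: increasing_comp.
  apply: Or33; rewrite -quot_family_comp // -/R -(dualK R) quot_dual //.
    by rewrite dR2 dual_frechet.
  by rewrite dualK.
have [h2 h2i] := dual_sub _ sdR undR; rewrite dualK => RdR2.
pose T := quot_family h2 R; have sT : semifilter T by apply: quot_semifilter.
have dT : dual T = T.
  rewrite -quot_dual //; apply/seteqP; split=> //; exact: image_subset.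
have [U ultraU] := ultrafilter_exists.
have [fU dU] := (ultrafilter_dualP U).1 ultraU; have [sU _] := fU.
have [h3 h3i dTU3] :=
  dual_sub _ (semifilterI sT sU) (self_dual_meets_ultrafilter sT dT ultraU).
have TU3 : quot_family h3 (T `|` U) `<=` quot_family h3 (T `&` U).
  apply: subset_trans dTU3; apply: image_subset.
  by rewrite dualI dT; apply/setUS/filter_sub_dual.
have TU : quot_family h3 T = quot_family h3 U.
  apply/seteqP; split.
    apply: subset_trans (image_subset _ (@subsetUl _ T U)) _.
    exact: subset_trans TU3 (image_subset _ (@subIsetr _ T U)).
  apply: subset_trans (image_subset _ (@subsetUr _ T U)) _.
  exact: subset_trans TU3 (image_subset _ (@subIsetl _ T U)).
exists (h1 \o h2 \o h3); first by do 2?apply: increasing_comp.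
apply: Or32; rewrite -(quot_family_comp _ (increasing_comp h1i h2i) h3i).
by rewrite -(quot_family_comp _ h1i h2i) -/R -/T TU; apply: quot_ultrafilter.
Qed.

Theorem theorem1p8 :
  [<-> semifilter_trichotomy;
       forall S : set (set nat), S `<=` infsets -> unbounded S ->
         exists2 h : nat -> nat, increasing h &
           (exists2 U, ultrafilter_on_nat U & base_for (quot_family h S) U)
           \/ base_for (quot_family h S) infsets;
       forall S : set (set nat), S `<=` infsets -> unbounded S ->
         exists2 h : nat -> nat, increasing h & reaping (quot_family h S)].
Proof.
tfae.
- exact: trichotomy_base.
- move=> base S Si unS; have [h hi /base_reaping Sh] := base S Si unS.
  by exists h.
- exact: reaping_trichotomy.
Qed.
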